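(* Let $b_L,b_R$ be functions of $t\ge0$ with $b_L(t)<0$ and $b_R(t)>0$. Consider the semi-discrete problem with non-reflecting boundary conditions for $\bar u(t)\in\mathbb{R}^N$, $$HP\,\bar u_{tt}-\tilde L\bar u+b^{-1}QPC^2\,\bar u_t=H\bar f,\qquad\bar u(0)=\bar u_t(0)=0,$$ where $b^{-1}Q=\mathrm{diag}(-1/b_L(t),0,\dots,0,1/b_R(t))$ and $\bar f(t)\in\mathbb{R}^N$. Put $G=HP$ (diagonal), $B(t)=b^{-1}QPC^2$, $A=-\tilde L$ and $F=H\bar f$. Then $B(t)\ge0$ is diagonal, $A$ is symmetric and positive definite modulo the constant vectors, and the explicit scheme $$G\,\frac{u^{k+1}-2u^k+u^{k-1}}{\tau^2}+B(k\tau)\,\frac{u^{k+1}-u^{k-1}}{2\tau}+Au^k=F^k,\quad k=1,2,\dots,\qquad u^0=u^1=0,\quad F^k=F(k\tau),$$ is stable under the condition $\tau\le2/\sqrt{(1+\varepsilon)\lambda_{\max}}$, $\varepsilon>0$. That is, let $V$ be the $G$-orthogonal complement of the constant vectors in $\mathbb{R}^N$, let $\Pi$ be the $G$-orthogonal projector onto $V$, and let $0<\lambda_{\min}\le\lambda_{\max}$ be such that $\lambda_{\min}(Gv,v)\le(Av,v)\le\lambda_{\max}(Gv,v)$ for all $v\in V$. Then for every $\varepsilon>0$ there is a constant $K>0$, independent of $k$, $\tau$ and $F$, such that for every $\tau>0$ satisfying the condition, $$\|\Pi u^{k+1}\|_G\le\frac{K}{\lambda_{\min}}\sqrt{\frac{1+\varepsilon}{\varepsilon}}\sum_{i=1}^k\tau\|F^i\|_G,\qquad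 k\ge1 .$$
   Context: The continuous problem is the wave equation $\rho\,\partial_t^2u-\partial_x(\rho c^2\partial_xu)=f$ on $[0,1]$, with smooth positive $\rho(x),c(x)$, zero initial data, and non-reflecting conditions $\partial_tu+b_L\partial_xu=0$ at $x=0$ and $\partial_tu+b_R\partial_xu=0$ at $x=1$. Grid: $0=x_1<x_2<\dots<x_N=1$. $P=\mathrm{diag}(\rho(x_n))$ and $C=\mathrm{diag}(c(x_n))$ are positive diagonal $N\times N$ matrices. $H$ is a diagonal $N\times N$ matrix with positive entries, $(u,v)_H=v^THu$, and $Q=\mathrm{diag}(-1,0,\dots,0,1)$. $D^+,D^-$ are $N\times N$ matrices approximating $\partial/\partial x$ at all grid points and satisfying the summation-by-parts (SBP) condition $$(u,D^+v)_H+(D^-u,v)_H=-u_1v_1+u_Nv_N\qquad\forall u,v\in\mathbb{R}^N .$$ The kernel of $D^+$ consists exactly of the constant vectors. The discrete spatial operator is $$\tilde L=HD^-PC^2D^+-QPC^2D^+ .$$ $(u,v)=v^Tu$ is the Euclidean scalar product and $\|v\|_G=(Gv,v)^{1/2}$. *)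

(* Defs.v *)
From HB Require Import structures.
From mathcomp Require Import all_boot all_order all_algebra.
From mathcomp Require Import reals topology normedtype derive.

Set Implicit Arguments.
Unset Strict Implicit.
Unset Printing Implicit Defensive.

Import Order.TTheory GRing.Theory Num.Theory.
Import numFieldNormedType.Exports.

Local Open Scope ring_scope.

(* Vectors are columns indexed by 'I_n.+1; the grid point x_1 is [ord0] and
   x_N is [ord_max], with N = n.+1. *)

(* Smoothness on the closed interval, as the restriction of a function that is
   smooth on the whole line: [derivable] is two-sided, so it could not be used
   directly at the end points. *)
Definition smooth01 (R : realType) (f : R -> R) : Prop :=
  exists2 g : R -> R,
    (forall (k : nat) (y : R), derivable (derive1n k g) y 1) &
    (forall y : R, 0 <= y <= 1 -> g y = f y).

Definition smooth_positive01 (R : realType) (f : R -> R) : Prop :=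
  smooth01 f /\ (forall y : R, 0 <= y <= 1 -> 0 < f y).

(* This forces N >= 2, so that [ord0] and [ord_max] differ. *)
Definition is_grid (R : realType) (n : nat) (x : 'I_n.+1 -> R) : Prop :=
  [/\ x ord0 = 0, x ord_max = 1 & forall i j : 'I_n.+1, (i < j)%N -> x i < x j].

Definition grid_diag (R : realType) (n : nat) (x : 'I_n.+1 -> R) (g : R -> R)
  : 'M[R]_n.+1 := diag_mx (\row_i g (x i)).

(* diag(l, 0, ..., 0, r) *)
Definition end_diag (R : realType) (n : nat) (l r : R) : 'M[R]_n.+1 :=
  diag_mx (\row_i (l *+ (i == ord0) + r *+ (i == ord_max))).

Definition positive_diag (R : realType) (n : nat) (M : 'M[R]_n.+1) : Prop :=
  is_diag_mx M /\ (forall i, 0 < M i i).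

(* (u, v) = v^T u *)
Definition dotp (R : realType) (n : nat) (u v : 'cV[R]_n.+1) : R :=
  (v^T *m u) ord0 ord0.

(* (u, v)_H = v^T H u *)
Definition dotp_on (R : realType) (n : nat) (H : 'M[R]_n.+1)
  (u v : 'cV[R]_n.+1) : R := (v^T *m H *m u) ord0 ord0.

Definition norm_on (R : realType) (n : nat) (G : 'M[R]_n.+1)
  (v : 'cV[R]_n.+1) : R := Num.sqrt (dotp (G *m v) v).

Definition constant_vec (R : realType) (n : nat) (v : 'cV[R]_n.+1) : Prop :=
  exists a : R, v = const_mx a.

Definition SBP (R : realType) (n : nat) (H Dp Dm : 'M[R]_n.+1) : Prop :=
  forall u v : 'cV[R]_n.+1,
    dotp_on H u (Dp *m v) + dotp_on H (Dm *m u) v =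
    - (u ord0 ord0 * v ord0 ord0) + u ord_max ord0 * v ord_max ord0.

Definition Ltilde (R : realType) (n : nat) (H P C Q Dp Dm : 'M[R]_n.+1)
  : 'M[R]_n.+1 :=
  H *m Dm *m P *m (C *m C) *m Dp - Q *m P *m (C *m C) *m Dp.

Definition possemidef (R : realType) (n : nat) (M : 'M[R]_n.+1) : Prop :=
  forall v : 'cV[R]_n.+1, 0 <= dotp (M *m v) v.

(* For symmetric M: the form (Mv, v) descends to the quotient of R^N by the
   constant vectors and is positive definite there. *)
Definition posdef_mod_constants (R : realType) (n : nat) (M : 'M[R]_n.+1)
  : Prop :=
  (forall v : 'cV[R]_n.+1, constant_vec v -> M *m v = 0) /\
  (forall v : 'cV[R]_n.+1, ~ constant_vec v -> 0 < dotp (M *m v) v).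

Definition in_V (R : realType) (n : nat) (G : 'M[R]_n.+1) (v : 'cV[R]_n.+1)
  : Prop :=
  forall w : 'cV[R]_n.+1, constant_vec w -> dotp (G *m v) w = 0.

Definition is_orth_projector_V (R : realType) (n : nat) (G Pi : 'M[R]_n.+1)
  : Prop :=
  forall v : 'cV[R]_n.+1,
    in_V G (Pi *m v) /\
    (forall w : 'cV[R]_n.+1, in_V G w -> dotp (G *m (v - Pi *m v)) w = 0).

Definition explicit_scheme (R : realType) (n : nat) (G : 'M[R]_n.+1)
  (B : R -> 'M[R]_n.+1) (A : 'M[R]_n.+1) (F : R -> 'cV[R]_n.+1)
  (tau : R) (u : nat -> 'cV[R]_n.+1) : Prop :=
  [/\ u 0%N = 0, u 1%N = 0 &
   forall k : nat, (0 < k)%N ->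
     G *m ((tau ^+ 2)^-1 *: (u k.+1 - 2 *: u k + u k.-1))
     + B (k%:R * tau) *m ((2 * tau)^-1 *: (u k.+1 - u k.-1))
     + A *m u k = F (k%:R * tau)].

(* Main.v *)
Require Import Defs.
From HB Require Import structures.
From mathcomp Require Import all_boot all_order all_algebra.
From mathcomp Require Import reals topology normedtype derive.
From mathcomp Require Import ring lra.

Set Implicit Arguments.
Unset Strict Implicit.
Unset Printing Implicit Defensive.

Import Order.TTheory GRing.Theory Num.Theory.
Import numFieldNormedType.Exports.

Local Open Scope ring_scope.

(** Summation by parts says, as a matrix identity, that
    Dp^T H + H Dm = Q.  Substituted into Ltilde, it turns the boundary term
    into the one that completes the square:
    A = Dp^T (H P C^2) Dp with H P C^2 a positive diagonal matrix.  Hence A is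
    symmetric, positive semidefinite, and its null space is that of Dp, the
    constant vectors ([Ltilde_SBP]).

    Stability comes from a discrete energy.  With d_k = u^{k+1} - u^k, put
      E_k = |d_k|_G^2 / tau^2 + (A u^{k+1}, u^k).
    Testing the scheme against u^{k+1} - u^{k-1} = d_k + d_{k-1} makes the G and
    A terms telescope, while the damping B only decreases the energy:
      E_k - E_{k-1} <= (F^k, d_k + d_{k-1})          ([energy_step]).
    The energy is not visibly nonnegative, but with the midpoint
    s = (u^{k+1} + u^k) / 2 one has
      (A u^{k+1}, u^k) = (A s, s) - (A d_k, d_k) / 4,
    and the step size restriction lets the kinetic term absorb the negative
    part, with the fraction eps / (1 + eps) of it left over
    ([energy_lower]).  So |d_k|_G <= tau sqrt((1 + eps) / eps) sqrt(E_k), the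
    energy inequality becomes linear in sqrt(E_k), and summing it bounds
    sqrt(E_k) by the accumulated source ([sqrt_energy_le]).  Here (F, d) is
    estimated by |F|_G |d|_G up to a constant depending on G alone, since F
    lives in the dual space ([dotp_le_diag_norm]).

    Finally u^{k+1} = s + d_k / 2: on V the energy controls s through lmin, and
    d_k was just bounded ([norm_projector_le_sqrt_energy]).  The constants are
    in the kernel of A and G-orthogonal to V, so all forms pass through Pi
    ([projector_quotient_forms]). *)

(** * Quadratic forms and the weighted norm *)

Lemma dotpE (R : realType) (n : nat) (u v : 'cV[R]_n.+1) :
  dotp u v = \sum_i u i ord0 * v i ord0.
Proof. by rewrite /dotp mxE; apply: eq_bigr => i _; rewrite mxE mulrC. Qed.

Lemma dotpC (R : realType) (n : nat) (u v : 'cV[R]_n.+1) : dotp u v = dotp v u.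
Proof. by rewrite !dotpE; apply: eq_bigr => i _; rewrite mulrC. Qed.

Lemma dotpDl (R : realType) (n : nat) (u v w : 'cV[R]_n.+1) :
  dotp (u + v) w = dotp u w + dotp v w.
Proof. by rewrite /dotp mulmxDr mxE. Qed.

Lemma dotpZl (R : realType) (n : nat) (a : R) (u v : 'cV[R]_n.+1) :
  dotp (a *: u) v = a * dotp u v.
Proof. by rewrite /dotp -scalemxAr mxE. Qed.

Lemma dotpNl (R : realType) (n : nat) (u v : 'cV[R]_n.+1) :
  dotp (- u) v = - dotp u v.
Proof. by rewrite /dotp mulmxN mxE. Qed.

Lemma dotpDr (R : realType) (n : nat) (u v w : 'cV[R]_n.+1) :
  dotp w (u + v) = dotp w u + dotp w v.
Proof. by rewrite dotpC dotpDl !(dotpC w). Qed.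

Lemma dotpZr (R : realType) (n : nat) (a : R) (u v : 'cV[R]_n.+1) :
  dotp u (a *: v) = a * dotp u v.
Proof. by rewrite dotpC dotpZl dotpC. Qed.

Lemma dotpNr (R : realType) (n : nat) (u v : 'cV[R]_n.+1) :
  dotp u (- v) = - dotp u v.
Proof. by rewrite dotpC dotpNl dotpC. Qed.

Definition dotpLR := (dotpDl, dotpDr, dotpZl, dotpZr, dotpNl, dotpNr).

Lemma dotp_adj (R : realType) (n : nat) (M : 'M[R]_n.+1) (u v : 'cV[R]_n.+1) :
  dotp (M *m u) v = dotp u (M^T *m v).
Proof. by rewrite /dotp trmx_mul trmxK mulmxA. Qed.

Lemma dotp_sym (R : realType) (n : nat) (M : 'M[R]_n.+1) (u v : 'cV[R]_n.+1) :
  M^T = M -> dotp (M *m u) v = dotp (M *m v) u.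
Proof. by move=> symM; rewrite dotp_adj symM dotpC. Qed.

(** Semidefiniteness at u - s v for every s makes a quadratic in s nonnegative,
    so its discriminant is nonpositive; as M may be degenerate, the quadratic
    can also reduce to an affine function of s. *)
Lemma cauchy_schwarz (R : realType) (n : nat) (M : 'M[R]_n.+1)
  (u v : 'cV[R]_n.+1) : M^T = M -> possemidef M ->
  dotp (M *m u) v ^+ 2 <= dotp (M *m u) u * dotp (M *m v) v.
Proof.
move=> symM psdM.
have trinomial_ge0 s : 0 <= dotp (M *m u) u - 2 * s * dotp (M *m u) v
    + s ^+ 2 * dotp (M *m v) v.
  have := psdM (u - s *: v).
  rewrite !(mulmxDr, mulmxN, =^~ scalemxAr, dotpLR) (dotp_sym v u symM).
  lra.
have := psdM v; rewrite le_eqVlt => /orP[/eqP vM0|vM_gt0].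
  rewrite -vM0 mulr0; case: (eqVneq (dotp (M *m u) v) 0) => [->|uv_neq0].
    by rewrite expr0n.
  (* the trinomial is now affine in s, and this s makes it equal to -1 *)
  have := trinomial_ge0 ((dotp (M *m u) u + 1) / (2 * dotp (M *m u) v)).
  rewrite -vM0 mulr0 addr0.
  have -> : 2 * ((dotp (M *m u) u + 1) / (2 * dotp (M *m u) v))
      * dotp (M *m u) v = dotp (M *m u) u + 1 by field.
  lra.
have := trinomial_ge0 (dotp (M *m u) v / dotp (M *m v) v).
set a := dotp (M *m u) u; set b := dotp (M *m v) v in vM_gt0 *.
set c := dotp (M *m u) v.
have -> : a - 2 * (c / b) * c + (c / b) ^+ 2 * b = a - c ^+ 2 / b.
  by field; exact: lt0r_neq0.
by rewrite subr_ge0 ler_pdivrMr.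
Qed.

Lemma norm_on_ge0 (R : realType) (n : nat) (G : 'M[R]_n.+1) (v : 'cV[R]_n.+1) :
  0 <= norm_on G v.
Proof. exact: sqrtr_ge0. Qed.

Lemma sqr_norm_on (R : realType) (n : nat) (G : 'M[R]_n.+1) (v : 'cV[R]_n.+1) :
  possemidef G -> norm_on G v ^+ 2 = dotp (G *m v) v.
Proof. by move=> psdG; rewrite sqr_sqrtr. Qed.

Lemma dotp_le_norm_on (R : realType) (n : nat) (G : 'M[R]_n.+1)
  (u v : 'cV[R]_n.+1) : G^T = G -> possemidef G ->
  dotp (G *m u) v <= norm_on G u * norm_on G v.
Proof.
move=> symG psdG; apply: le_trans (ler_norm _) _.
rewrite -(ler_pXn2r (_ : 0 < 2)%N) ?nnegrE ?mulr_ge0 ?norm_on_ge0 //.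
by rewrite -normrX ger0_norm ?sqr_ge0 // exprMn !sqr_norm_on ?cauchy_schwarz.
Qed.

Lemma norm_on_triangle (R : realType) (n : nat) (G : 'M[R]_n.+1)
  (u v : 'cV[R]_n.+1) : G^T = G -> possemidef G ->
  norm_on G (u + v) <= norm_on G u + norm_on G v.
Proof.
move=> symG psdG.
rewrite -(ler_pXn2r (_ : 0 < 2)%N) ?nnegrE ?addr_ge0 ?norm_on_ge0 //.
rewrite sqrrD !sqr_norm_on // !(mulmxDr, dotpLR) (dotp_sym v u symG).
have := dotp_le_norm_on u v symG psdG; lra.
Qed.

Lemma norm_onZ (R : realType) (n : nat) (G : 'M[R]_n.+1) (a : R)
  (v : 'cV[R]_n.+1) : 0 <= a -> norm_on G (a *: v) = a * norm_on G v.
Proof.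
move=> a_ge0; rewrite /norm_on -scalemxAr !dotpLR mulrA -expr2.
by rewrite sqrtrM ?sqr_ge0 // sqrtr_sqr ger0_norm.
Qed.

Lemma dotp_diag (R : realType) (n : nat) (d : 'rV[R]_n.+1) (u v : 'cV[R]_n.+1) :
  dotp (diag_mx d *m u) v = \sum_i d ord0 i * (u i ord0 * v i ord0).
Proof.
by rewrite dotpE; apply: eq_bigr => i _; rewrite mul_diag_mx mxE mulrA.
Qed.

Lemma possemidef_diag (R : realType) (n : nat) (d : 'rV[R]_n.+1) :
  (forall i, 0 <= d ord0 i) -> possemidef (diag_mx d).
Proof.
move=> d_ge0 v; rewrite dotp_diag; apply: sumr_ge0 => i _.
by rewrite mulr_ge0 // -expr2 sqr_ge0.
Qed.

Lemma diag_form_eq0 (R : realType) (n : nat) (d : 'rV[R]_n.+1)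
  (v : 'cV[R]_n.+1) : (forall i, 0 < d ord0 i) ->
  dotp (diag_mx d *m v) v = 0 -> v = 0.
Proof.
move=> d_gt0; rewrite dotp_diag => /eqP; rewrite psumr_eq0; last first.
  by move=> i _; rewrite mulr_ge0 ?(ltW (d_gt0 i)) // -expr2 sqr_ge0.
move=> /allP v0; apply/colP => i; rewrite mxE.
have := v0 i (mem_index_enum i); rewrite mulf_eq0 (gt_eqF (d_gt0 i)) /=.
by rewrite mulf_eq0 orbb => /eqP.
Qed.

(** The norm dual to |.|_G is the one of G^-1, whereas the source is to be
    measured in |.|_G itself; in finite dimension the two are equivalent.
    The constant arises from |w| <= sqrt kappa |w|_G, applied to both factors. *)
Lemma dotp_le_diag_norm (R : realType) (n : nat) (d : 'rV[R]_n.+1)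
  (f v : 'cV[R]_n.+1) : (forall i, 0 < d ord0 i) ->
  dotp f v <= (\sum_i (d ord0 i)^-1) *
    norm_on (diag_mx d) f * norm_on (diag_mx d) v.
Proof.
move=> d_gt0; set kappa := \sum_i _.
have kappa_ge i : (d ord0 i)^-1 <= kappa.
  rewrite /kappa (bigD1 i) //= lerDl sumr_ge0 // => j _.
  by rewrite invr_ge0 ltW.
have kappa_ge0 : 0 <= kappa.
  by apply: sumr_ge0 => i _; rewrite invr_ge0 ltW.
have psd1 : possemidef (1%:M : 'M[R]_n.+1).
  by move=> w; rewrite mul1mx dotpE sumr_ge0 // => i _; rewrite -expr2 sqr_ge0.
have le_kappa w : norm_on 1%:M w <= Num.sqrt kappa * norm_on (diag_mx d) w.
  rewrite -sqrtrM // ler_wsqrtr // mul1mx dotp_diag dotpE mulr_sumr.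
  apply: ler_sum => i _.
  have : 1 <= kappa * d ord0 i by rewrite -ler_pdivrMr // div1r.
  by move=> /(ler_wpM2r (sqr_ge0 (w i ord0))); rewrite mul1r expr2 -mulrA.
have := dotp_le_norm_on f v (trmx1 _ _) psd1; rewrite mul1mx => /le_trans; apply.
apply: le_trans (ler_pM (norm_on_ge0 _ _) (norm_on_ge0 _ _)
  (le_kappa f) (le_kappa v)) _.
by rewrite mulrACA -expr2 sqr_sqrtr // mulrA.
Qed.

(** * The discrete spatial operator *)

Lemma SBP_matrix (R : realType) (n : nat) (H Dp Dm : 'M[R]_n.+1) :
  SBP H Dp Dm -> Dp^T *m H + H *m Dm = end_diag n (-1) 1.
Proof.
move=> sbp; apply/matrixP => i j.
have entry (M : 'M[R]_n.+1) :
    ((delta_mx i 0 : 'cV_n.+1)^T *m M *m (delta_mx j 0 : 'cV_n.+1)) ord0 ord0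
    = M i j.
  by rewrite trmx_delta -rowE -colE !mxE.
have := sbp (delta_mx j 0) (delta_mx i 0).
rewrite /dotp_on trmx_mul !mulmxA -(mulmxA _ _ H) -(mulmxA _ H Dm) !entry.
rewrite [X in _ -> X = _]mxE => ->; rewrite !mxE !eqxx !andbT.
rewrite !(eq_sym ord0) !(eq_sym ord_max).
(* off the diagonal, i and j cannot both be the same end point *)
have offdiag k : i != j -> (j == k)%:R * (i == k)%:R = 0 :> R.
  by case: (eqVneq j k) => [<- /negPf ->|]; rewrite ?mulr0 ?mul0r.
case: (eqVneq i j) => [<-|/offdiag ij0]; last by rewrite !ij0 oppr0 addr0.
by case: (i == _); case: (i == _); rewrite /= ?mulr1n ?mulr0n; ring.
Qed.

(** The factor H Dm is Q - Dp^T H, and the boundary part of Ltilde is exactly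
    what cancels its Q. *)
Lemma Ltilde_SBP (R : realType) (n : nat) (H P C Dp Dm : 'M[R]_n.+1) :
  SBP H Dp Dm ->
  - Ltilde H P C (end_diag n (-1) 1) Dp Dm = Dp^T *m (H *m P *m (C *m C)) *m Dp.
Proof.
move=> /SBP_matrix <-; by rewrite /Ltilde -!mulmxA mulmxDl -!mulmxA opprB addrK.
Qed.

(** * The discrete energy *)

(** Divides p^2 - q^2 = (p - q)(p + q) by p + q, which may vanish. *)
Lemma sqr_diff_le (R : realType) (p q a : R) :
  0 <= p -> 0 <= q -> 0 <= a -> p ^+ 2 - q ^+ 2 <= a * (p + q) -> p <= q + a.
Proof.
move=> p0 q0 a0; rewrite subr_sqr.
case: (ltrP q p) => [qp|pq _]; last by rewrite (le_trans pq) // lerDl.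
rewrite ler_pM2r ?lerBlDl //; lra.
Qed.

(** The potential part (A b, a) couples two consecutive time levels, so that it
    telescopes: the scheme evaluates A at the middle level only. *)
Definition energy (R : realType) (n : nat) (G A : 'M[R]_n.+1) (tau : R)
  (a b : 'cV[R]_n.+1) : R :=
  (tau ^+ 2)^-1 * dotp (G *m (b - a)) (b - a) + dotp (A *m b) a.

(** Testing against c - a, with (c - b) + (b - a) = c - a: the G term becomes a
    difference of squares, A telescopes by symmetry, and B dissipates. *)
Lemma energy_step (R : realType) (n : nat) (G B A : 'M[R]_n.+1) (tau : R)
  (a b c f : 'cV[R]_n.+1) :
  G^T = G -> A^T = A -> possemidef B -> 0 < tau ->
  G *m ((tau ^+ 2)^-1 *: (c - 2 *: b + a))
    + B *m ((2 * tau)^-1 *: (c - a)) + A *m b = f ->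
  energy G A tau b c - energy G A tau a b <= dotp f (c - a).
Proof.
move=> symG symA psdB tau_gt0 <-.
have B_ge0 : 0 <= dotp (B *m ((2 * tau)^-1 *: (c - a))) (c - a).
  rewrite -scalemxAr dotpZl mulr_ge0 // invr_ge0; lra.
rewrite 2!dotpDl [leRHS]addrAC.
suff -> : energy G A tau b c - energy G A tau a b =
  dotp (G *m ((tau ^+ 2)^-1 *: (c - 2 *: b + a))) (c - a) +
  dotp (A *m b) (c - a) by rewrite lerDl.
rewrite /energy !(mulmxDr, mulmxN, =^~ scalemxAr, dotpLR).
rewrite (dotp_sym c b symA) (dotp_sym c b symG) (dotp_sym c a symG).
rewrite (dotp_sym b a symG); ring.
Qed.

(** Polarization around the midpoint (a + b) / 2 leaves a negative term
    - (A (b - a), b - a) / 4; the step size condition says that it is at most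
    the fraction 1 / (1 + eps) of the kinetic energy. *)
Lemma energy_lower (R : realType) (n : nat) (G A : 'M[R]_n.+1)
  (tau eps lmax : R) (a b : 'cV[R]_n.+1) :
  A^T = A -> possemidef G -> 0 < tau -> 0 < eps ->
  tau ^+ 2 * ((1 + eps) * lmax) <= 4 ->
  (forall v, dotp (A *m v) v <= lmax * dotp (G *m v) v) ->
  (tau ^+ 2)^-1 * (eps / (1 + eps)) * dotp (G *m (b - a)) (b - a)
    + dotp (A *m (2^-1 *: (b + a))) (2^-1 *: (b + a)) <= energy G A tau a b.
Proof.
move=> symA psdG tau_gt0 eps_gt0 cfl leA; rewrite /energy.
have -> : dotp (A *m b) a = dotp (A *m (2^-1 *: (b + a))) (2^-1 *: (b + a))
    - dotp (A *m (b - a)) (b - a) / 4.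
  rewrite !(mulmxDr, mulmxN, =^~ scalemxAr, dotpLR) (dotp_sym a b symA).
  by field.
set s := dotp _ (2^-1 *: _); have := leA (b - a).
have := psdG (b - a); set g := dotp (G *m _) _; set h := dotp (A *m _) _.
move=> g_ge0 le_h.
have lmax_le : lmax / 4 <= (tau ^+ 2)^-1 * (1 + eps)^-1.
  rewrite -invfM ler_pdivrMr // mulrC ler_pdivlMr; last first.
    by rewrite mulr_gt0 ?exprn_gt0 //; lra.
  lra.
have -> : (tau ^+ 2)^-1 * (eps / (1 + eps)) =
    (tau ^+ 2)^-1 - (tau ^+ 2)^-1 * (1 + eps)^-1.
  field; rewrite !lt0r_neq0 //; lra.
have := ler_wpM2r g_ge0 lmax_le; lra.
Qed.

Lemma diff_le_sqrt_energy (R : realType) (n : nat) (G A : 'M[R]_n.+1)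
  (tau eps lmax : R) (a b : 'cV[R]_n.+1) :
  A^T = A -> possemidef A -> possemidef G -> 0 < tau -> 0 < eps ->
  tau ^+ 2 * ((1 + eps) * lmax) <= 4 ->
  (forall v, dotp (A *m v) v <= lmax * dotp (G *m v) v) ->
  norm_on G (b - a) <=
    tau * Num.sqrt ((1 + eps) / eps) * Num.sqrt (energy G A tau a b).
Proof.
move=> symA psdA psdG tau_gt0 eps_gt0 cfl leA.
have := energy_lower a b symA psdG tau_gt0 eps_gt0 cfl leA.
have := psdA (2^-1 *: (b + a)); set h := dotp _ (2^-1 *: _) => h_ge0 low.
have q_gt0 : 0 < (1 + eps) / eps by rewrite divr_gt0 //; lra.
have t_gt0 : 0 < tau ^+ 2 * ((1 + eps) / eps) by rewrite mulr_gt0 ?exprn_gt0.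
have g_le : dotp (G *m (b - a)) (b - a) <=
    tau ^+ 2 * ((1 + eps) / eps) * energy G A tau a b.
  rewrite -ler_pdivrMl // invfM invf_div; lra.
have E_ge0 : 0 <= energy G A tau a b.
  by rewrite -(pmulr_rge0 _ t_gt0) (le_trans _ g_le).
rewrite -(ler_pXn2r (_ : 0 < 2)%N) ?nnegrE ?norm_on_ge0 //; last first.
  by rewrite !mulr_ge0 ?sqrtr_ge0 // ltW.
by rewrite !exprMn sqr_norm_on // !sqr_sqrtr // ltW.
Qed.

(** Both increments in (F^k, d_k + d_{k-1}) are bounded by square roots of
    energies, so the square roots, unlike the energies, obey a linear recursion
    without growth: no Gronwall factor appears. *)
Lemma sqrt_energy_le (R : realType) (n : nat) (G A : 'M[R]_n.+1)
  (B : R -> 'M[R]_n.+1) (F : R -> 'cV[R]_n.+1) (u : nat -> 'cV[R]_n.+1)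
  (tau eps lmax kappa : R) :
  G^T = G -> possemidef G -> A^T = A -> possemidef A ->
  (forall t, 0 <= t -> possemidef (B t)) ->
  0 < tau -> 0 < eps -> tau ^+ 2 * ((1 + eps) * lmax) <= 4 ->
  (forall v, dotp (A *m v) v <= lmax * dotp (G *m v) v) ->
  0 <= kappa ->
  (forall f v, dotp f v <= kappa * norm_on G f * norm_on G v) ->
  explicit_scheme G B A F tau u ->
  forall k, Num.sqrt (energy G A tau (u k) (u k.+1)) <=
    kappa * Num.sqrt ((1 + eps) / eps) *
    \sum_(1 <= i < k.+1) tau * norm_on G (F (i%:R * tau)).
Proof.
move=> symG psdG symA psdA psdB tau_gt0 eps_gt0 cfl leA kappa_ge0 dualG.
case=> u0 u1 step.
set E := fun k => energy G A tau (u k) (u k.+1).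
set gam := Num.sqrt ((1 + eps) / eps).
have gam2 : gam ^+ 2 = (1 + eps) / eps.
  by rewrite sqr_sqrtr // divr_ge0 //; lra.
have E_ge0 k : 0 <= E k.
  apply: le_trans (energy_lower _ _ symA psdG tau_gt0 eps_gt0 cfl leA).
  rewrite addr_ge0 // mulr_ge0 // mulr_ge0 ?invr_ge0 ?sqr_ge0 //.
  by rewrite divr_ge0 //; lra.
have diff_le k := diff_le_sqrt_energy (u k) (u k.+1)
  symA psdA psdG tau_gt0 eps_gt0 cfl leA.
elim=> [|k IHk].
  rewrite big_nil mulr0 u0 u1 /energy subr0 !mulmx0.
  by rewrite /dotp mulmx0 mxE mulr0 addr0 sqrtr0.
rewrite big_nat_recr //= mulrDr; apply: le_trans (lerD IHk (lexx _)).
set phi := norm_on G (F (k.+1%:R * tau)).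
apply: sqr_diff_le; rewrite ?sqrtr_ge0 //.
  by rewrite !mulr_ge0 ?sqrtr_ge0 ?norm_on_ge0 // ltW.
rewrite !sqr_sqrtr ?E_ge0 //.
have t_ge0 : 0 <= k.+1%:R * tau by rewrite mulr_ge0 // ltW.
apply: le_trans (energy_step symG symA (psdB _ t_ge0) tau_gt0 (step k.+1 _)) _.
  by [].
apply: le_trans (dualG _ _) _; rewrite -/phi /=.
have -> : u k.+2 - u k = (u k.+2 - u k.+1) + (u k.+1 - u k).
  by rewrite addrA subrK.
have := norm_on_triangle (u k.+2 - u k.+1) (u k.+1 - u k) symG psdG.
move=> /le_trans/(_ (lerD (diff_le k.+1) (diff_le k))).
move=> /(ler_wpM2l (_ : 0 <= kappa * phi))-/(_ _)/le_trans; apply.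
  by rewrite mulr_ge0 ?norm_on_ge0.
by rewrite -/(E _) -/(E _) -/gam le_eqVlt; apply/orP; left; apply/eqP; ring.
Qed.

(** * The projection modulo constants *)

(** The double G-orthogonal complement of the constants: subtracting from w its
    G-projection a e on e = (1, ..., 1) leaves a vector of V that is
    G-orthogonal to itself. *)
Lemma constant_of_orthogonal_V (R : realType) (n : nat) (d : 'rV[R]_n.+1)
  (w : 'cV[R]_n.+1) : (forall i, 0 < d ord0 i) ->
  (forall v, in_V (diag_mx d) v -> dotp (diag_mx d *m w) v = 0) ->
  constant_vec w.
Proof.
move=> d_gt0 w_orth; set G := diag_mx d in w_orth *.
pose e : 'cV[R]_n.+1 := const_mx 1.
have cE (a : R) : const_mx a = a *: e by apply/matrixP => i j; rewrite !mxE mulr1.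
have Gee : dotp (G *m e) e != 0.
  apply/eqP => /(diag_form_eq0 d_gt0)/colP/(_ ord0).
  by rewrite !mxE; apply/eqP; rewrite oner_eq0.
pose a := dotp (G *m w) e / dotp (G *m e) e.
have Gwae : dotp (G *m (w - a *: e)) e = 0.
  rewrite !(mulmxDr, mulmxN, =^~ scalemxAr, dotpLR) /a; field.
  exact: Gee.
have Vwa : in_V G (w - a *: e).
  by move=> _ [b ->]; rewrite cE dotpZr Gwae mulr0.
exists a; rewrite cE; apply/subr0_eq/(diag_form_eq0 d_gt0).
have Ge_wa : dotp (G *m e) (w - a *: e) = 0.
  by rewrite dotp_sym ?Gwae // tr_diag_mx.
rewrite -/G; set z := w - a *: e in Ge_wa Vwa *.
rewrite {1}/z mulmxDr mulmxN -scalemxAr dotpDl dotpNl dotpZl Ge_wa.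
by rewrite mulr0 subr0 w_orth.
Qed.

(** v - Pi v is constant, hence killed by A and G-orthogonal to Pi v. *)
Lemma projector_quotient_forms (R : realType) (n : nat) (d : 'rV[R]_n.+1)
  (A Pi : 'M[R]_n.+1) (v : 'cV[R]_n.+1) : (forall i, 0 < d ord0 i) ->
  A^T = A -> (forall w : 'cV[R]_n.+1, constant_vec w -> A *m w = 0) ->
  is_orth_projector_V (diag_mx d) Pi ->
  [/\ in_V (diag_mx d) (Pi *m v),
      dotp (A *m (Pi *m v)) (Pi *m v) = dotp (A *m v) v
    & dotp (diag_mx d *m (Pi *m v)) (Pi *m v) <= dotp (diag_mx d *m v) v].
Proof.
move=> d_gt0 symA kerA projPi.
have [VPi orthPi] := projPi v.
have w_const := constant_of_orthogonal_V d_gt0 orthPi.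
have psdG := possemidef_diag (fun i => ltW (d_gt0 i)).
have symG := tr_diag_mx d.
set G := diag_mx d in VPi orthPi psdG symG *; set p := Pi *m v in VPi *.
set w := v - p in w_const; have -> : v = p + w by rewrite addrC subrK.
clearbody p w.
have Apw : dotp (A *m p) w = 0.
  by rewrite dotp_sym // (kerA w) // /dotp mulmx0 mxE.
split=> //; first by rewrite mulmxDr (kerA w) // addr0 dotpDr Apw addr0.
have Gpw : dotp (G *m p) w = 0 by exact: VPi.
have Gwp : dotp (G *m w) p = 0 by rewrite dotp_sym.
have := psdG w; rewrite mulmxDr !dotpLR Gpw Gwp; lra.
Qed.

(** b is the midpoint (a + b) / 2 plus half the increment b - a; the potential
    part of the energy controls the first modulo constants, the kinetic part
    the second. *)
Lemma norm_projector_le_sqrt_energy (R : realType) (n : nat) (d : 'rV[R]_n.+1)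
  (A Pi : 'M[R]_n.+1) (tau eps lmin lmax : R) (a b : 'cV[R]_n.+1) :
  (forall i, 0 < d ord0 i) ->
  A^T = A -> possemidef A ->
  (forall w : 'cV[R]_n.+1, constant_vec w -> A *m w = 0) ->
  is_orth_projector_V (diag_mx d) Pi -> 0 < lmin ->
  (forall v, in_V (diag_mx d) v ->
     lmin * dotp (diag_mx d *m v) v <= dotp (A *m v) v) ->
  0 < tau -> 0 < eps -> tau ^+ 2 * ((1 + eps) * lmax) <= 4 ->
  (forall v, dotp (A *m v) v <= lmax * dotp (diag_mx d *m v) v) ->
  norm_on (diag_mx d) (Pi *m b) <=
    ((Num.sqrt lmin)^-1 + 2^-1 * tau * Num.sqrt ((1 + eps) / eps)) *
    Num.sqrt (energy (diag_mx d) A tau a b).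
Proof.
move=> d_gt0 symA psdA kerA projPi lmin_gt0 geA tau_gt0 eps_gt0 cfl leA.
have psdG := possemidef_diag (fun i => ltW (d_gt0 i)).
have symG := tr_diag_mx d; set G := diag_mx d in projPi geA leA psdG symG *.
have low := energy_lower a b symA psdG tau_gt0 eps_gt0 cfl leA.
have diff_le := diff_le_sqrt_energy a b symA psdA psdG tau_gt0 eps_gt0 cfl leA.
set s := 2^-1 *: (b + a) in low.
have -> : Pi *m b = Pi *m s + 2^-1 *: (Pi *m (b - a)).
  rewrite scalemxAr -mulmxDr -scalerDr addrACA subrr addr0.
  by rewrite -(mulr2n b) -(scaler_nat 2 b) scalerA mulVf ?scale1r ?pnatr_eq0.
apply: le_trans (norm_on_triangle _ _ symG psdG) _.
rewrite norm_onZ ?invr_ge0 // mulrDl; apply: lerD.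
  have [VPi APi _] := projector_quotient_forms s d_gt0 symA kerA projPi.
  rewrite -sqrtrV ?(ltW lmin_gt0) // -sqrtrM ?invr_ge0 ?(ltW lmin_gt0) //.
  apply: ler_wsqrtr.
  rewrite ler_pdivlMl // (le_trans (geA _ VPi)) // APi (le_trans _ low) //.
  rewrite lerDr mulr_ge0 // mulr_ge0 ?invr_ge0 ?sqr_ge0 //.
  by rewrite divr_ge0 //; lra.
have [_ _ GPi] := projector_quotient_forms (b - a) d_gt0 symA kerA projPi.
rewrite -!mulrA ler_wpM2l ?invr_ge0 // mulrA; apply: le_trans diff_le.
exact: ler_wsqrtr.
Qed.

(** * Stability of the explicit scheme *)

Theorem theorem3 (R : realType) (n : nat) (x : 'I_n.+1 -> R)
  (rho c : R -> R) (H Dp Dm : 'M[R]_n.+1) (bL bR : R -> R)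
  (hgrid : is_grid x)
  (hrho : smooth_positive01 rho) (hc : smooth_positive01 c)
  (hH : positive_diag H)
  (hSBP : SBP H Dp Dm)
  (hker : forall v : 'cV[R]_n.+1, Dp *m v = 0 <-> constant_vec v)
  (hbL : forall t : R, 0 <= t -> bL t < 0)
  (hbR : forall t : R, 0 <= t -> 0 < bR t) :
  let P := grid_diag x rho in
  let C := grid_diag x c in
  let Q := end_diag n (-1) 1 in
  let binvQ := fun t : R => end_diag n (- (bL t)^-1) (bR t)^-1 in
  let G := H *m P in
  let B := fun t : R => binvQ t *m P *m (C *m C) in
  let A := - Ltilde H P C Q Dp Dm in
  [/\ is_diag_mx G,
      forall t : R, 0 <= t -> is_diag_mx (B t) /\ possemidef (B t),
      A^T = A /\ posdef_mod_constants A &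
      forall (Pi : 'M[R]_n.+1) (lmin lmax : R),
        is_orth_projector_V G Pi ->
        0 < lmin -> lmin <= lmax ->
        (forall v : 'cV[R]_n.+1, in_V G v ->
           lmin * dotp (G *m v) v <= dotp (A *m v) v /\
           dotp (A *m v) v <= lmax * dotp (G *m v) v) ->
        forall eps : R, 0 < eps ->
        exists K : R, 0 < K /\
          forall (tau : R) (f : R -> 'cV[R]_n.+1) (u : nat -> 'cV[R]_n.+1),
            0 < tau -> tau <= 2 / Num.sqrt ((1 + eps) * lmax) ->
            let F := fun t : R => H *m f t in
            explicit_scheme G B A F tau u ->
            forall k : nat, (0 < k)%N ->
              norm_on G (Pi *m u k.+1) <=
              K / lmin * Num.sqrt ((1 + eps) / eps) *
              \sum_(1 <= i < k.+1) tau * norm_on G (F (i%:R * tau))].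
Proof.
move=> P C Q binvQ G B A.
have x01 i : 0 <= x i <= 1.
  have [x0 x1 x_incr] := hgrid; rewrite -{1}x0 -x1; apply/andP; split.
    case: (eqVneq i ord0) => [->|i_neq0] //.
    by apply/ltW/x_incr; rewrite lt0n.
  case: (eqVneq i ord_max) => [->|i_neqm] //.
  apply/ltW/x_incr; rewrite ltn_neqAle -ltnS ltn_ord andbT.
  by apply: contra i_neqm => /eqP im; apply/eqP/val_inj.
have rho_gt0 i : 0 < rho (x i) by case: hrho => _; apply.
have c_gt0 i : 0 < c (x i) by case: hc => _; apply.
have [/diag_mxP[h hE] Hpos] := hH.
have h_gt0 i : 0 < h ord0 i by have := Hpos i; rewrite hE mxE eqxx.
pose g := \row_i (h ord0 i * rho (x i)).
have g_gt0 i : 0 < g ord0 i by rewrite mxE mulr_gt0.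
have GE : G = diag_mx g.
  rewrite /G hE mulmx_diag; congr diag_mx.
  by apply/rowP => i; rewrite !mxE.
have CCE : C *m C = diag_mx (\row_i (c (x i) ^+ 2)).
  by rewrite mulmx_diag; congr diag_mx; apply/rowP => i; rewrite !mxE expr2.
pose w := \row_i (g ord0 i * c (x i) ^+ 2).
have w_gt0 i : 0 < w ord0 i by rewrite mxE mulr_gt0 ?exprn_gt0.
have AE : A = Dp^T *m diag_mx w *m Dp.
  rewrite /A Ltilde_SBP //; congr (_ *m _ *m _).
  rewrite -/G GE CCE mulmx_diag; congr diag_mx.
  by apply/rowP => i; rewrite !mxE.
have symA : A^T = A.
  by rewrite AE !trmx_mul trmxK tr_diag_mx mulmxA.
have formA v : dotp (A *m v) v = dotp (diag_mx w *m (Dp *m v)) (Dp *m v).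
  by rewrite AE -!mulmxA dotp_adj trmxK.
have psdA : possemidef A.
  by move=> v; rewrite formA; apply: possemidef_diag => i; apply: ltW.
have kerA v : constant_vec v -> A *m v = 0.
  by move=> /hker Dv0; rewrite AE -mulmxA Dv0 mulmx0.
have psdB t : 0 <= t -> is_diag_mx (B t) /\ possemidef (B t).
  move=> t_ge0; rewrite /B CCE !mulmx_diag; split; first exact: diag_mx_is_diag.
  apply: possemidef_diag => i; rewrite !mxE.
  rewrite mulr_ge0 ?sqr_ge0 // mulr_ge0 ?(ltW (rho_gt0 i)) //.
  rewrite addr_ge0 // mulrn_wge0 // ?oppr_ge0 ?invr_le0 ?invr_ge0 ltW //.
    exact: hbL.
  exact: hbR.
split=> //; first by rewrite GE diag_mx_is_diag.
  split=> //; split=> // v v_nconst; rewrite lt0r psdA andbT.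
  rewrite formA; apply/eqP => /(diag_form_eq0 w_gt0) Dv0.
  by apply: v_nconst; apply/hker.
move=> Pi lmin lmax projPi lmin_gt0 le_lmin_lmax boundsA eps eps_gt0.
rewrite GE in projPi boundsA *.
have lmax_gt0 : 0 < lmax := lt_le_trans lmin_gt0 le_lmin_lmax.
have sl_gt0 : 0 < Num.sqrt ((1 + eps) * lmax).
  by rewrite sqrtr_gt0 mulr_gt0 //; lra.
pose kappa := \sum_i (g ord0 i)^-1.
have kappa_gt0 : 0 < kappa.
  rewrite /kappa (bigD1 ord0) //= ltr_wpDr ?invr_gt0 ?g_gt0 //.
  by apply: sumr_ge0 => i _; rewrite invr_ge0 ltW.
pose gam := Num.sqrt ((1 + eps) / eps).
have gam_ge0 : 0 <= gam := sqrtr_ge0 _.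
(* the CFL bound turns tau / 2 into the inverse square root below, which
   makes the constant independent of tau *)
pose K0 := (Num.sqrt lmin)^-1 + (Num.sqrt ((1 + eps) * lmax))^-1 * gam.
have K0_gt0 : 0 < K0.
  by rewrite ltr_wpDr ?invr_gt0 ?sqrtr_gt0 // mulr_ge0 // invr_ge0 ltW.
(* lmin cancels the denominator prescribed in the estimate *)
exists (lmin * (K0 * kappa)); split; first by rewrite !mulr_gt0.
move=> tau f u tau_gt0 tau_le F scheme k k_gt0.
have leA v : dotp (A *m v) v <= lmax * dotp (diag_mx g *m v) v.
  have [VPi <- GPi] := projector_quotient_forms v g_gt0 symA kerA projPi.
  have [_ /le_trans] := boundsA _ VPi; apply.
  by rewrite ler_wpM2l // ltW.
have geA v : in_V (diag_mx g) v ->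
    lmin * dotp (diag_mx g *m v) v <= dotp (A *m v) v.
  by move=> /boundsA[].
have cfl : tau ^+ 2 * ((1 + eps) * lmax) <= 4.
  move: tau_le; rewrite ler_pdivlMr // => tau_le.
  have el_ge0 : 0 <= (1 + eps) * lmax by rewrite mulr_ge0 ?ltW //; lra.
  rewrite -(sqr_sqrtr el_ge0) -exprMn (_ : 4 = 2 ^+ 2); last by ring.
  by rewrite ler_pXn2r ?nnegrE ?mulr_ge0 // ltW.
have := norm_projector_le_sqrt_energy (u k) (u k.+1) g_gt0 symA psdA kerA
  projPi lmin_gt0 geA tau_gt0 eps_gt0 cfl leA.
move=> /le_trans; apply.
have := sqrt_energy_le (tr_diag_mx g) (possemidef_diag (fun i => ltW (g_gt0 i)))
  symA psdA (fun t t_ge0 => (psdB t t_ge0).2) tau_gt0 eps_gt0 cfl leA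
  (ltW kappa_gt0) (fun f v => dotp_le_diag_norm f v g_gt0) scheme k.
set S := \sum_(_ <= _ < _) _ => E_le.
have -> : lmin * (K0 * kappa) / lmin * gam * S = K0 * (kappa * gam * S).
  by field; exact: lt0r_neq0.
apply: ler_pM (sqrtr_ge0 _) _ E_le.
  by rewrite addr_ge0 ?mulr_ge0 ?invr_ge0 ?sqrtr_ge0 ?(ltW tau_gt0).
by rewrite /K0 lerD2l ler_wpM2r //; move: tau_le; lra.
Qed.
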